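(* Let $k\geq 2$. The number $\sigma_k(t)$ of $k$-hops joining $0$ to $t\in[0,kr]$ can be written as the (non-compensated) multiple Poisson stochastic integral $$\sigma_k(t)=\int_0^t\cdots\int_0^t f_k(s_1,\ldots,s_{k-1})\,dN_{s_1}\cdots dN_{s_{k-1}},\qquad t\in[0,kr],$$ where $f_k$ is the function of $k-1$ variables defined as $$f_k(s_1,\ldots,s_{k-1}):=\prod_{l=0}^{k-1}\mathbf 1_{\{s_{l+1}<s_l+r\}},\qquad s_1,\ldots,s_{k-1}\in[0,t],$$ with $s_0:=0$ and $s_k:=t$.
   Context: Let $r>0$ be the connection radius of the one-dimensional unit disk random graph. Nodes are distributed on $[0,kr]$ according to a Poisson point process with counting process $(N_t)_{t\in[0,kr]}$ and intensity $\lambda(ds)=\sum_{l=1}^k\mathbf 1_{((l-1)r,lr]}(s)\,\lambda_l((l-1)r+ds)$, where $\lambda_l(ds)=\lambda_l(s)ds$, $l=1,\ldots,k$, are absolutely continuous intensity measures on $[0,r]$; that is, the intensity on the cell $((l-1)r,lr]$ is $\lambda_l$ with coordinate measured from the left endpoint $(l-1)r$. Additional nodes are located at $0$ and at $t\in[0,kr]$. Two nodes $s,t\in[0,kr]$ are connected if and only if $|t-s|\le r$. $\sigma_k(t)$ denotes the count of $k$-hops between the nodes at $0$ and $t$, a $k$-hop being a path made of $k$ edges that links $0$ to $t$ through $k-1$ nodes of the Poisson process.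
   Formalization: The identity is stated almost surely for each fixed t in [(k-1)r, kr] rather than for all t in [0,kr]: for smaller t it fails, e.g. k=2, t=r/2, where a node in (t,r] gives a 2-hop that the integral over [0,t] misses. *)

(* Defs.v *)
From HB Require Import structures.
From mathcomp Require Import all_boot all_order all_algebra finmap.
From mathcomp Require Import all_classical all_reals all_analysis.

Set Implicit Arguments.
Unset Strict Implicit.
Unset Printing Implicit Defensive.

Import Order.TTheory GRing.Theory Num.Theory.
Import numFieldTopology.Exports numFieldNormedType.Exports.

Local Open Scope classical_set_scope.
Local Open Scope ring_scope.

Section PointConfigurations.
Context {R : realType}.
Implicit Types (S : {fset R}) (A : set R) (t : R).

Definition count_in S A : nat := #|` [fset x in S | x \in A]%fset|.

(* The path t |-> N_t of the counting process; it vanishes for t < 0. *)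
Definition counting_path S t : R := (count_in S `[0, t])%:R.

Lemma counting_path_nondecreasing S : nondecreasing (counting_path S).
Proof.
move=> x y xy; rewrite /counting_path ler_nat.
apply: fsubset_leq_card; apply/fsubsetP => z; rewrite !inE /= => /andP[-> /=].
rewrite !mem_setE !in_itv/= => /andP[-> zx] /=; exact: le_trans zx xy.
Qed.

Lemma counting_path_right_continuous S :
  right_continuous (counting_path S).
Proof.
move=> t; apply: cvg_near_cst.
have H : \forall y \near t^'+, forall x : S, ~~ (t < val x <= y).
  apply: filter_forall => x; have [tx|xt] := ltP t (val x).
    near=> y; rewrite /= -ltNge.
    by near: y; exact: nbhs_right_lt.
  by near=> y.
near=> y; rewrite /counting_path; congr (_%:R).
have ty : t < y by near: y; exact: nbhs_right_gt.
have Hy : forall x : S, ~~ (t < val x <= y) by near: y; exact: H.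
rewrite /count_in; congr (size (enum_fset _)); apply/fsetP => z.
rewrite !inE /=; have [zS|//] := boolP (z \in S) => /=.
rewrite !mem_setE !in_itv/=; congr (_ && _); apply/idP/idP => [zy|zt].
  by move: (Hy [` zS]%fset) => /=; rewrite zy andbT -leNgt.
exact: le_trans zt (ltW ty).
Unshelve. all: by end_near.
Qed.

HB.instance Definition _ S := isCumulative.Build R _ R (counting_path S)
  (@counting_path_nondecreasing S) (@counting_path_right_continuous S).

(* dN_s, pathwise. *)
Definition dN S := lebesgue_stieltjes_measure (counting_path S).

End PointConfigurations.

Section PoissonPointProcess.
Context {R : realType} {d : measure_display} {T : measurableType d}.
Variable P : probability T R.

(* A Poisson process with diffuse intensity of finite mass on E is simple and
   a.s. finite, so it is given by the random finite set eta of its nodes.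
   Lambda must be finite on E, because of [fine]. The argument 0 of
   [poisson_prob] is a dummy one in the library. *)
Record poisson_point_process (E : set R) (Lambda : set R -> \bar R)
    (eta : T -> {fset R}) : Prop := {
  ppp_support : forall w x, x \in eta w -> E x;
  ppp_measurable : forall A, measurable A -> A `<=` E ->
    measurable_fun setT (fun w => count_in (eta w) A);
  ppp_law : forall A, measurable A -> A `<=` E -> forall B : set nat,
    P [set w | B (count_in (eta w) A)] = poisson_prob (fine (Lambda A)) 0 B;
  ppp_independent : forall (n : nat) (A : 'I_n -> set R) (B : 'I_n -> set nat),
    (forall i, measurable (A i)) -> (forall i, A i `<=` E) ->
    trivIset setT A ->
    P (\bigcap_i [set w | B i (count_in (eta w) (A i))]) =
    (\prod_(i < n) P [set w | B i (count_in (eta w) (A i))])%E }.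

End PoissonPointProcess.

Section UnitDiskGraph.
Context {R : realType}.

(* The cells are numbered from 0, so that [lam l] is the density lambda_(l+1). *)
Definition intensity (k : nat) (r : R) (lam : 'I_k -> R -> R) (A : set R) :
    \bar R :=
  (\int[lebesgue_measure]_(s in A)
     (\sum_(l < k) \1_(`](l%:R * r), (l.+1%:R * r)]%classic) s
                   * lam l (s - l%:R * r))%:E)%E.

Definition connected_nodes (r : R) : rel R := fun s t => `|t - s| <= r.

(* Number of k-hops from 0 to t through the node set S: a path is listed, from
   0 to t, by its k - 1 pairwise distinct intermediate nodes. *)
Definition hop_count (k : nat) (r t : R) (S : {fset R}) : nat :=
  #|[pred s : (k.-1).-tuple S |
      uniq s && path (connected_nodes r) 0 (rcons (map val s) t)]|.

Definition f_hop (k : nat) (r t : R) (s : (k.-1).-tuple R) : R :=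
  let x := 0 :: rcons s t in
  \prod_(l < k) (nth 0 x l.+1 < nth 0 x l + r)%R%:R.

End UnitDiskGraph.

(* The multiple integral of f(s_1, ..., s_n) against mu(ds_1) ... mu(ds_n) over
   D^n minus its diagonals, with ds_1 innermost. Excluding the diagonals is the
   usual convention for multiple stochastic integrals. *)
Fixpoint multiple_integral {R : realType} {d : measure_display}
    {X : measurableType d} (mu : set X -> \bar R) (D : set X) (n : nat) :
    (n.-tuple X -> \bar R) -> \bar R :=
  match n with
  | 0 => fun f => f [tuple]
  | m.+1 => fun f => multiple_integral mu D
      (fun s : m.-tuple X =>
         (\int[mu]_(x in D `\` [set` s]) f [tuple of x :: s])%E)
  end.

(* Main.v *)
(* The mass points of dN are the nodes, so the multiple integral is the sum of
   f_k over the tuples of distinct nodes of [0, t]; both sides thus count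
   tuples, and it remains to compare the two conditions on a tuple. As
   t >= (k-1)r, steps of at most r force (l-1)r <= s_l <= lr, whence
   s_l <= s_(l+1) and s_l in [0, t], so that the one-sided condition
   s_(l+1) <= s_l + r is equivalent to |s_(l+1) - s_l| <= r. The strict and the
   weak inequality differ only if a node sits at r or at t - r, or if two nodes
   are at distance exactly r, and these events are null. For the last one, cut
   [0, kr] into cells I_i of small length: N(I_i) and N(I_i + r) are
   independent, so the probability is at most
   sum_i Lambda(I_i) Lambda(I_i + r) <= Lambda([0, kr]) max_i Lambda(I_i + r),
   which vanishes with the mesh by absolute continuity of the integral. *)
Require Import Defs.
From HB Require Import structures.
From mathcomp Require Import all_boot all_order all_algebra finmap.
From mathcomp Require Import all_classical all_reals all_analysis.
From mathcomp Require Import measurable_realfun lra.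

Set Implicit Arguments.
Unset Strict Implicit.
Unset Printing Implicit Defensive.

Import Order.TTheory GRing.Theory Num.Theory.
Import numFieldTopology.Exports numFieldNormedType.Exports.

Local Open Scope classical_set_scope.
Local Open Scope ring_scope.

(** * Translation invariance and integrability of the intensity *)

(* The Lebesgue and Stieltjes measures of the library live on measurableTypeR R,
   whose structure is convertible to that of R but not unified with it. *)
Lemma measurable_shift (R : realType) (c : R) :
  measurable_fun setT (fun x : measurableTypeR R => x + c : measurableTypeR R).
Proof.
have mc : measurable_fun [set: R] (fun x : R => x + c).
  by apply: measurable_funD.
exact: mc.
Qed.

(** Lebesgue measure is determined by its values on half-open intervals, whose lengths a translation
    preserves. *)
Lemma lebesgue_measure_shift (R : realType) (c : R) (A : set R) :
  measurable A ->
  pushforward (@lebesgue_measure R) (fun x : R => (x + c : measurableTypeR R)) A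
  = lebesgue_measure A.
Proof.
move=> mA; apply/esym.
pose phi : {mfun measurableTypeR R >-> measurableTypeR R} :=
  MeasurableFun.Pack (MeasurableFun.Class
    (isMeasurableFun.Build _ _ _ _ _ (measurable_shift c))).
apply: (@lebesgue_measure_unique R (pushforward (@lebesgue_measure R) phi))
  => //= _ [[a b]] _ <-.
rewrite /pushforward (_ : _ @^-1` _ = `]a - c, b - c]%classic); last first.
  by apply/seteqP; split => x /=; rewrite !in_itv/= ltrBlDr lerBrDr.
rewrite /= !lebesgue_measure_itv/= !lte_fin ltrD2r.
by case: ifPn => // _; rewrite -!EFinD opprB addrA subrK.
Qed.

Lemma integrable_shift (R : realType) (c : R) (h : R -> \bar R) :
  (@lebesgue_measure R).-integrable setT h ->
  (@lebesgue_measure R).-integrable setT (fun x => h (x - c)).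
Proof.
move=> /integrableP[mh hfin].
pose phi : {mfun measurableTypeR R >-> measurableTypeR R} :=
  MeasurableFun.Pack (MeasurableFun.Class
    (isMeasurableFun.Build _ _ _ _ _ (measurable_shift c))).
have mhc : measurable_fun setT (fun x : R => h (x - c)).
  exact: (measurableT_comp mh (measurable_shift (- c))).
apply/integrableP; split=> //.
(* Replacing Lebesgue measure by its image under x -> x + c turns h (x - c) back into h x. *)
rewrite (eq_measure_integral
  (pushforward (@lebesgue_measure R) phi)); last first.
  by move=> A mA _; apply/esym/lebesgue_measure_shift.
have mshift := @measurable_shift R c.
rewrite ge0_integral_pushforward//=; last exact: measurableT_comp.
under eq_integral do rewrite /= addrK.
by rewrite preimage_setT.
Qed.

Lemma integrable_cell_density (R : realType) (k : nat) (r : R)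
    (lam : 'I_k -> R -> R) :
  (forall l, (@lebesgue_measure R).-integrable `[0, r] (EFin \o lam l)) ->
  (@lebesgue_measure R).-integrable setT (EFin \o (fun s => \sum_(l < k)
    \1_(`](l%:R * r), (l.+1%:R * r)]%classic) s * lam l (s - l%:R * r))).
Proof.
move=> lam_int; rewrite /comp; under eq_fun do rewrite -sumEFin.
apply: integrable_sum => // l _.
(* Each summand is a translate of [lam l] cut off to []0, r]]; the cut-off comes first because
   [lam l] is controlled only on [[0, r]]. *)
rewrite (_ : (fun _ => _) = (fun s : R =>
    ((EFin \o lam l) \_ `]0, r]) (s - l%:R * r))); last first.
  apply/funext => s; rewrite patchE indicE !mem_setE !in_itv/=.
  rewrite subr_gt0 lerBlDr -nat1r mulrDl mul1r.
  by case: ifPn; rewrite ?mul1r ?mul0r.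
apply: integrable_shift; apply: (iffLR (integrable_mkcond _ _)) => //.
by apply: (integrableS _ _ _ (lam_int l)) => //; exact: subset_itv_oc_cc.
Qed.

Lemma cell_density_ge0 (R : realType) (k : nat) (r : R) (lam : 'I_k -> R -> R) :
  (forall l s, 0 <= s <= r -> 0 <= lam l s) ->
  forall s, 0 <= \sum_(l < k)
    \1_(`](l%:R * r), (l.+1%:R * r)]%classic) s * lam l (s - l%:R * r).
Proof.
move=> lam_ge0 s; apply: sumr_ge0 => l _; rewrite indicE.
case: (boolP (s \in _)); rewrite mem_setE in_itv/= ?mul1r ?mul0r//.
move=> /andP[ls sl].
apply: lam_ge0; rewrite subr_ge0 ltW//=.
by rewrite lerBlDr (le_trans sl)// -nat1r mulrDl mul1r.
Qed.

(** * The Stieltjes measure dN as a sum of Dirac masses *)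

Section counting_measure.
Context {R : realType} (S : {fset R}).

Lemma count_inE (A : set R) :
  (count_in S A)%:R%:E = (\sum_(x <- S) \d_x A)%E :> \bar R.
Proof.
rewrite /count_in card_fset_sum1 big_fset /= natr_sum big_mkcond -sumEFin.
by apply: eq_bigr => x _; rewrite diracE; case: ifP.
Qed.

Lemma counting_path_itv (a b : R) : (forall x, x \in S -> 0 <= x) -> a <= b ->
  (counting_path S b - counting_path S a)%:E =
  (\sum_(x <- S) \d_x `]a, b]%classic)%E.
Proof.
move=> S0 ab; rewrite /counting_path EFinB !count_inE !sumEFin -EFinB -sumrB.
congr EFin.
apply: eq_big_seq => x xS; rewrite !indicE !mem_setE !in_itv/= (S0 _ xS)/=.
have [xa|ax] := leP x a; first by rewrite (le_trans xa ab) subrr.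
by rewrite subr0.
Qed.

(** A Stieltjes measure is determined by its values on half-open intervals. The nodes have to be
    nonnegative because [counting_path] counts on [[0, t]] only and would miss the others. *)
Lemma dNE (A : set (measurableTypeR R)) :
  (forall x, x \in S -> 0 <= x) -> measurable A ->
  dN S A = (\sum_(x <- S) \d_x A)%E.
Proof.
move=> S0 mA.
rewrite (big_nth 0) big_mkord.
pose m_ (i : nat) : {measure set (measurableTypeR R) -> \bar R} :=
  dirac (nth 0 S i : measurableTypeR R).
rewrite /dN.
apply: (@lebesgue_stieltjes_measure_unique R (counting_path S)
  (msum m_ (size S))) => //.
move=> _ [[a b] _ <-] /=.
rewrite /lebesgue_stieltjes_measure /measure_extension measurable_mu_extE/=;
  last exact: is_ocitv.
have [ab|ba] := leP a b; last first.
  rewrite set_itv_ge ?bnd_simp -?leNgt ?ltW// wlength0.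
  by rewrite measure0.
rewrite wlength_itv_bnd// counting_path_itv//.
by rewrite (big_nth 0) big_mkord.
Qed.

Lemma integral_dN (D : set (measurableTypeR R))
    (f : measurableTypeR R -> \bar R) :
  (forall x, x \in S -> 0 <= x) -> measurable D ->
  measurable_fun D f -> (forall x, D x -> 0 <= f x)%E ->
  (\int[dN S]_(x in D) f x = \sum_(x : S | val x \in D) f (val x))%E.
Proof.
move=> S0 mD mf f0.
pose m_ (i : nat) : {measure set (measurableTypeR R) -> \bar R} :=
  dirac (nth 0 S i : measurableTypeR R).
rewrite (@eq_measure_integral _ _ _ D (msum m_ (size S))
  (lebesgue_stieltjes_measure (counting_path S))); last first.
  move=> A mA _; have /= := dNE S0 mA; rewrite /dN => ->.
  by rewrite (big_nth 0) big_mkord.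
rewrite (@ge0_integral_measure_sum _ _ R m_)//.
rewrite -(big_seq_fsetE _ S (fun x : R => x \in D) f) [RHS]big_mkcond.
rewrite [RHS](big_nth 0) big_mkord; apply: eq_bigr => i _.
rewrite integral_dirac// diracE.
by case: ifPn => _ /=; rewrite ?mul1e ?mul0e.
Qed.

End counting_measure.

(** * Multiple integrals against dN as sums over tuples of nodes *)

Lemma measurable_has d (T : measurableType d) (I : Type) (r : seq I)
    (b : I -> T -> bool) :
  (forall i, measurable_fun setT (b i)) ->
  measurable_fun setT (fun x => has (b^~ x) r).
Proof. by move=> mb; elim: r => [|i r IH] //=; exact: measurable_or. Qed.

(** The diagonal removed from an inner integral depends on the remaining variables; this keeps that
    integral measurable in them. *)
Lemma measurable_mem_tuple (R : realType) n (x : measurableTypeR R) :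
  measurable_fun setT (fun s : n.-tuple (measurableTypeR R) => x \in (s : seq R)).
Proof.
rewrite (_ : (fun _ => _) = (fun s : n.-tuple (measurableTypeR R) =>
    has (fun i => tnth s i == x :> R) (enum 'I_n))); last first.
  apply/funext => s; apply/idP/hasP => [/tnthP[i ->]|[i _ /eqP <-]].
    by exists i => //; exact: mem_enum.
  exact: mem_tnth.
apply: measurable_has => i.
have mx := @measurable_fun_eqr _ _ R setT _ _
  (@measurable_tnth _ (measurableTypeR R) n i) (measurable_cst x).
exact: mx.
Qed.

Lemma measurable_set_seq (R : realType) (s : seq (measurableTypeR R)) :
  measurable [set` s].
Proof.
elim: s => [|x s IH]; first by rewrite set_nil.
rewrite (_ : [set` _] = [set x] `|` [set` s]).
  by apply: measurableU => //; exact: measurable_set1.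
apply/seteqP; split=> y /=; rewrite inE.
  by case/orP => [/eqP|]; [left|right].
by case=> [->|->]; rewrite ?eqxx ?orbT.
Qed.

Section multiple_integral_dN.
Context {R : realType} (S : {fset R}) (D : set (measurableTypeR R)).
Hypotheses (S0 : forall x, x \in S -> 0 <= x) (mD : measurable D).

(** By induction on n: the innermost integral becomes a finite sum by [integral_dN], and removing
    the diagonals at each stage amounts to [uniq]. *)
Lemma multiple_integral_dN n (f : n.-tuple (measurableTypeR R) -> \bar R) :
  (forall s, 0 <= f s)%E -> measurable_fun setT f ->
  multiple_integral (dN S) D f =
  (\sum_(s : n.-tuple S | uniq s && all (fun x => val x \in D) s)
     f (map_tuple val s))%E.
Proof.
elim: n f => [|n IH] f f0 mf /=.
  rewrite (big_pred1 [tuple]); first by congr f; exact: val_inj.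
  by move=> s; rewrite tuple0.
transitivity (multiple_integral (dN S) D
  (fun s : n.-tuple (measurableTypeR R) =>
   \sum_(x : S | (val x \in D) && (val x \notin (s : seq R)))
     f [tuple of val x :: s])%E).
  congr multiple_integral; apply/funext => s.
  rewrite integral_dN//; last 2 first.
  - by apply: measurableD => //; exact: measurable_set_seq.
  - apply: measurable_funTS; apply: (measurableT_comp mf).
    exact: measurable_cons.
  apply: eq_bigl => x.
  by rewrite in_setD mem_setE.
rewrite IH; last 2 first.
- by move=> s; apply: sume_ge0.
- under eq_fun do rewrite big_mkcond.
  apply: emeasurable_sum => x; apply: measurable_fun_ifT => //.
  + apply: measurable_and => //.
    by apply: measurable_neg; exact: measurable_mem_tuple.
  + by apply: (measurableT_comp mf); exact: measurable_cons.
rewrite [RHS](reindex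
  (fun p : n.-tuple S * S => [tuple of p.2 :: p.1])); last first.
  exists (fun t => (behead_tuple t, thead t)) => [[s x]|t] _ /=.
    by congr pair; exact: val_inj.
  by apply: val_inj; rewrite /= [in RHS](tuple_eta t).
rewrite pair_big_dep /=; apply: eq_big => [[s x]|[s x] _] /=; last first.
  by congr f; exact: val_inj.
rewrite (mem_map val_inj).
by case: (uniq s) (all _ _) (fsval x \in D) (x \notin s) => [] [] [] [].
Qed.
End multiple_integral_dN.

(** * Comparison of the two conditions on a tuple *)

Section hops.
Context {R : realType}.

Lemma prodr_bool (n : nat) (b : 'I_n -> bool) :
  \prod_(l < n) (b l)%:R = [forall l, b l]%:R :> R.
Proof.
case: forallP => [bT|/forallP/forallPn/=[l bl]].
  by apply: big1 => l _; rewrite bT.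
by rewrite (bigD1 l)//= (negbTE bl) mul0r.
Qed.

Variables (k : nat) (r t : R) (s : seq R).
Hypotheses (hk : (2 <= k)%N) (hr : 0 < r) (ht : k.-1%:R * r <= t).
Hypothesis hs : size s = k.-1.
(** [X l] is the s_l of the theorem, with s_0 = 0 and s_k = t. *)
Let X l := nth 0 (0 :: rcons s t) l.

Let Xk : X k = t.
Proof. by rewrite /X -(prednK (ltnW hk)) /= nth_rcons hs ltnn eqxx. Qed.

Let X_mem l : (0 < l < k)%N -> X l \in s.
Proof.
case: l => // l /= lk; rewrite /X /= nth_rcons hs.
have lk' : (l < k.-1)%N by rewrite -ltnS prednK// (ltnW hk).
by rewrite lk'; apply: mem_nth; rewrite hs.
Qed.

Lemma hop_node_le : (forall l, (l < k)%N -> X l.+1 <= X l + r) ->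
  forall l, (l <= k)%N -> X l <= l%:R * r.
Proof.
move=> step; elim=> [_|l IH lk]; first by rewrite mul0r.
by rewrite (le_trans (step _ lk))// -natr1 mulrDl mul1r lerD2r IH// ltnW.
Qed.

Lemma hop_node_ge : (forall l, (l < k)%N -> X l.+1 <= X l + r) ->
  forall l, (l <= k)%N -> t - l%:R * r <= X (k - l)%N.
Proof.
move=> step; elim=> [_|l IH lk]; first by rewrite mul0r subr0 subn0 Xk.
rewrite -natr1 mulrDl mul1r opprD addrA lerBlDr (le_trans (IH (ltnW lk)))//.
by rewrite -(subnSK lk); apply: step; rewrite ltn_subrL (ltnW hk).
Qed.

(** Chain: X l <= l r <= t - (k - l - 1) r <= X (l + 1), where the middle inequality is (k - 1) r <=
    t. *)
Lemma hop_node_nondecreasing : (forall l, (l < k)%N -> X l.+1 <= X l + r) ->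
  forall l, (l < k)%N -> X l <= X l.+1.
Proof.
move=> step l lk.
apply: (le_trans (hop_node_le step (ltnW lk))).
have := hop_node_ge step (leq_subr l.+1 k); rewrite subKn//; apply: le_trans.
rewrite lerBrDr (le_trans _ ht)// -mulrDl -natrD ler_pM2r// ler_nat.
by rewrite -ltnS prednK ?(ltnW hk)// -addSn subnKC.
Qed.

Lemma path_hopE :
  (forall x, x \in s -> 0 <= x) ->
  r \notin s -> (forall x, x \in s -> x + r != t) ->
  (forall x y, x \in s -> y \in s -> y != x + r) ->
  path (connected_nodes r) 0 (rcons s t) =
  [forall l : 'I_k, X l.+1 < X l + r] && all (fun x => 0 <= x <= t) s.
Proof.
move=> s0 rs st ss.
have sz : size (rcons s t) = k by rewrite size_rcons hs prednK// (ltnW hk).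
apply/(pathP 0)/andP; rewrite sz.
  move=> conn.
  have step l : (l < k)%N -> X l.+1 <= X l + r.
    move=> /conn; rewrite /connected_nodes -/(X l) -/(X l.+1).
    by rewrite ler_distl => /andP[].
  split.
    apply/forallP => l; rewrite lt_neqAle step// andbT.
    (* Equality in a step is excluded by [rs] for the first step, by [ss] between two nodes and by
       [st] for the last step. *)
    have [->|l0] := posnP l.
      rewrite {2}/X /= add0r; apply: contraNneq rs => <-.
      by apply: X_mem; rewrite hk.
    have Xl : X l \in s by apply: X_mem; rewrite l0 ltn_ord.
    have [lk|] := ltnP l.+1 k; first by apply: ss => //; apply: X_mem.
    move=> kl; have -> : l.+1 = k by apply/eqP; rewrite eqn_leq kl ltn_ord.
    by rewrite Xk eq_sym st.
  (* A node is some X i with 1 <= i <= k - 1, hence at most (k - 1) r <= t. *)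
  apply/allP => x xs; rewrite s0//=; apply: le_trans ht.
  have := xs; rewrite -index_mem hs => xi.
  have -> : x = X (index x s).+1.
    by rewrite /X /= nth_rcons hs xi nth_index.
  have ik : ((index x s).+1 <= k)%N.
    by rewrite (leq_trans xi)// leq_pred.
  by rewrite (le_trans (hop_node_le step ik))// ler_pM2r// ler_nat.
move=> [/forallP step _] l lk.
have step' i : (i < k)%N -> X i.+1 <= X i + r.
  by move=> ik; exact: ltW (step (Ordinal ik)).
rewrite /connected_nodes -/(X l) -/(X l.+1) ger0_norm ?subr_ge0;
  last exact: hop_node_nondecreasing.
by rewrite lerBlDl step'.
Qed.

End hops.

(** * Probability that a Poisson process hits a set *)

Section poisson_process.
Context {R : realType} {d : measure_display} {T : measurableType d}.

(** This is 1 - exp (- q) <= q. *)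
Lemma poisson_prob_gt0_le (q : R) : 0 <= q ->
  (poisson_prob q 0 [set n | (0 < n)%N] <= q%:E)%E.
Proof.
move=> q0; have -> : [set n | (0 < n)%N] = ~` [set 0%N].
  by apply/seteqP; split => n /=; rewrite lt0n => /eqP.
rewrite probability_setC//= /poisson_prob.
have [{}q0|q_le0] := ltP 0 q.
  rewrite esum_set1 ?lee_fin ?poisson_pmf_ge0//.
  rewrite /poisson_pmf q0 expr0 fact0 invr1 !mul1r.
  by rewrite lerBlDr -lerBlDl expR_ge1Dx.
(* Here q = 0, where [poisson_prob] is the Dirac mass at 0. *)
by rewrite diracE mem_set//= subee.
Qed.

(** Intersecting covers of probability at most 1 / (n + 1) gives a measurable null set containing
    N. *)
Lemma negligible_le_small (P : probability T R) (N : set T) :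
  (forall e : R, 0 < e ->
    exists B, [/\ measurable B, (P B <= e%:E)%E & N `<=` B]) ->
  P.-negligible N.
Proof.
move=> H; have /choice[B BP] n :
    exists B, [/\ measurable B, (P B <= n.+1%:R^-1%:E)%E & N `<=` B].
  by apply: H; rewrite invr_gt0.
have mB : measurable (\bigcap_n B n).
  by apply: bigcapT_measurable => n; case: (BP n).
exists (\bigcap_n B n); split => //; last first.
  by move=> x Nx n _; case: (BP n) => _ _; exact.
apply/eqP; rewrite eq_le measure_ge0 andbT.
apply/lee_addgt0Pr => e e0; rewrite add0e.
near \oo => n.
case: (BP n) => mBn Pn _.
have BnS : \bigcap_n B n `<=` B n by exact: bigcap_inf.
apply: (@le_trans _ _ (P (B n))); first by apply: le_measure BnS; rewrite inE.
apply: (le_trans Pn); rewrite lee_fin ltW//.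
by near: n; exact: near_infty_natSinv_lt (PosNum e0).
Unshelve. all: by end_near. Qed.

Variable eta : T -> {fset R}.

Definition hit A : set T := [set w | (0 < count_in (eta w) A)%N].
Variables (P : probability T R) (E : set R) (Lambda : set R -> \bar R).
Hypothesis heta : poisson_point_process P E Lambda eta.


Lemma count_in_gt0 (S : {fset R}) (A : set R) x :
  x \in S -> A x -> (0 < count_in S A)%N.
Proof.
move=> xS Ax; rewrite /count_in cardfs_gt0; apply/fset0Pn; exists x.
by rewrite !inE/= xS mem_set.
Qed.

Lemma measurable_hit A : measurable A -> A `<=` E -> measurable (hit A).
Proof.
move=> mA AE; rewrite -[hit A]setTI.
have /(_ [set n | (0 < n)%N]) := ppp_measurable heta mA AE measurableT.
exact.
Qed.

Lemma ppp_hit_le A : measurable A -> A `<=` E -> 0 <= fine (Lambda A) ->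
  (P (hit A) <= (fine (Lambda A))%:E)%E.
Proof.
move=> mA AE L0; rewrite /hit (ppp_law heta mA AE [set n | (0 < n)%N]).
exact: poisson_prob_gt0_le.
Qed.

Lemma ppp_hitI A B : measurable A -> A `<=` E -> measurable B -> B `<=` E ->
  A `&` B = set0 -> P (hit A `&` hit B) = (P (hit A) * P (hit B))%E.
Proof.
move=> mA AE mB BE AB.
pose C (i : 'I_2) := if i == 0 :> nat then A else B.
have := ppp_independent heta (A := C) (fun=> [set n | (0 < n)%N]).
rewrite big_ord_recl big_ord1 /= => <-.
- congr (P _); apply/seteqP; split => w /=.
    by move=> [wA wB] [[|[|//]] ?] _.
  by move=> H; split; [exact: (H ord0)|exact: (H ord_max)].
- by move=> i; rewrite /C; case: ifP.
- by move=> i; rewrite /C; case: ifP.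
- move=> [[|[|//]] ?] [[|[|//]] ?] _ _ //=; rewrite /C/=.
  + by move=> _; apply/val_inj.
  + by rewrite AB => -[].
  + by rewrite setIC AB => -[].
  + by move=> _; apply/val_inj.
Qed.

End poisson_process.

(** * Null events for a diffuse intensity *)

Section diffuse_poisson_process.
Context {R : realType} {d : measure_display} {T : measurableType d}.
Variables (P : probability T R) (K : R) (g : R -> R) (eta : T -> {fset R}).
Let Lambda (A : set R) : \bar R := (\int[lebesgue_measure]_(s in A) (g s)%:E)%E.
Hypotheses (g0 : forall s, 0 <= g s)
  (ig : (@lebesgue_measure R).-integrable setT (EFin \o g))
  (heta : poisson_point_process P `[0, K] Lambda eta).

Let Lambda_ge0 A : (0 <= Lambda A)%E.
Proof. by apply: integral_ge0 => x _; rewrite lee_fin. Qed.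

Let Lambda_fin A : measurable A -> Lambda A \is a fin_num.
Proof. by move=> mA; apply: integrable_fin_num => //; exact: integrableS ig. Qed.

Let hit_le A : measurable A -> A `<=` `[0, K] -> (P (hit eta A) <= Lambda A)%E.
Proof.
move=> mA AE; rewrite -[leRHS]fineK ?Lambda_fin//.
by apply: (ppp_hit_le heta mA AE); rewrite fine_ge0.
Qed.

(** A point of [[0, K]] has intensity zero, and there are no nodes elsewhere. *)
Lemma ppp_node_negligible x : P.-negligible [set w | x \in eta w].
Proof.
have [xE|xE] := pselect (`[0, K]%classic x); last first.
  rewrite (_ : mkset _ = set0); first exact: negligible_set0.
  by apply/seteqP; split => w //= xw; exact: xE (ppp_support heta xw).
have xS : [set x] `<=` `[0, K] by move=> _ ->.
exists (hit eta [set x]); split.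
- exact: (measurable_hit heta).
- apply/eqP; rewrite eq_le measure_ge0 andbT (le_trans (hit_le _ _))//.
  by rewrite /Lambda integral_set1.
- by move=> w /= xw; apply: count_in_gt0 xw _.
Qed.

Lemma ppp_pair_negligible r : 0 < r ->
  P.-negligible [set w | exists2 x, x \in eta w & x + r \in eta w].
Proof.
move=> r0; apply: negligible_le_small => e e0.
have [K0|K0] := ltP K 0.
  exists set0; split; rewrite ?measure0 ?lee_fin ?ltW//.
  move=> w [x /(ppp_support heta)/=]; rewrite in_itv/= => /andP[x0 xK].
  by have := le_lt_trans (le_trans x0 xK) K0; rewrite ltxx.
pose M := fine (Lambda `[0, K]).
have M0 : 0 <= M by rewrite fine_ge0.
(* The final bound is M e / (M + 1) <= e; adding 1 avoids dividing by zero when M = 0. *)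
have [|D [D0 smallD]] := integral_normr_continuous ig (e := e / (M + 1)).
  by rewrite divr_gt0// ltr_wpDl.
(* h < D makes the intensity of each [B i] small; h <= r makes [A i] and [B i] disjoint, so that
   their hits are independent. *)
pose h := Num.min (D / 2) r.
have h0 : 0 < h by rewrite lt_min r0 divr_gt0.
have hD : h < D by rewrite gt_min ltr_pdivrMr// ltr_pMr// ltr1n.
have hr : h <= r by rewrite ge_min lexx orbT.
(* K < N h, so the first N cells cover [[0, K]]. *)
pose N := Num.bound (K / h).
pose A (i : nat) := `[0, K]%classic `&` `[i%:R * h, i.+1%:R * h[%classic.
pose B (i : nat) := `[0, K]%classic `&` `[i%:R * h + r, i.+1%:R * h + r[%classic.
have mA i : measurable (A i) by exact: measurableI.
have mB i : measurable (B i) by exact: measurableI.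
have AE i : A i `<=` `[0, K] by move=> x [].
have BE i : B i `<=` `[0, K] by move=> x [].
have AB i : A i `&` B i = set0.
  apply/seteqP; split => // x [[_ /= xi] [_ /= ix]].
  move: xi ix; rewrite !in_itv/= => /andP[_ xi] /andP[ix _].
  have := le_lt_trans ix xi; rewrite -natr1 mulrDl mul1r ltrD2l.
  by rewrite ltNge hr.
exists (\big[setU/set0]_(i < N) (hit eta (A i) `&` hit eta (B i))); split.
- apply: bigsetU_measurable => i _.
  by apply: measurableI; exact: (measurable_hit heta).
- apply: (le_trans (Boole_inequality P
    (A := fun i => hit eta (A i) `&` hit eta (B i)) _)).
    by move=> i _; apply: measurableI; exact: (measurable_hit heta).
  apply: (@le_trans _ _ (\sum_(i < N) Lambda (A i) * (e / (M + 1))%:E)%E).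
    apply: lee_sum => i _; rewrite [leLHS](ppp_hitI heta)//.
    apply: lee_pmul => //; first exact: hit_le.
    apply: (le_trans (hit_le _ _)) => //.
    rewrite -[leLHS]fineK ?Lambda_fin// lee_fin ltW//.
    have := smallD (B i) (mB i); rewrite /Rintegral.
    under eq_integral do rewrite /= ger0_norm//.
    apply.
    apply: (@le_lt_trans _ _ h%:E); last by rewrite lte_fin.
    apply: (@le_trans _ _
        (lebesgue_measure `[i%:R * h + r, i.+1%:R * h + r[%classic)).
      apply: le_measure.
      + by rewrite inE; exact: mB.
      + by rewrite inE; exact: measurable_itv.
      + exact: subIsetr.
    rewrite lebesgue_measure_itv/= lte_fin.
    case: ifP => _; last by rewrite lee_fin ltW.
    by rewrite -EFinB lee_fin -natr1; lra.
  rewrite -ge0_sume_distrl//.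
  apply: (@le_trans _ _ (M%:E * (e / (M + 1))%:E)%E); last first.
    rewrite -EFinM lee_fin mulrCA ger_pMr//.
    rewrite ler_pdivrMr ?mul1r; last by rewrite ltr_wpDl.
    by rewrite lerDl.
  apply: lee_wpmul2r; first by rewrite lee_fin divr_ge0 ?ltW ?ltr_wpDl.
  rewrite fineK ?Lambda_fin// /Lambda.
  rewrite -(big_mkord xpredT
    (fun i => \int[lebesgue_measure]_(s in A i) (g s)%:E)%E).
  have mg (D' : set R) : measurable_fun D' (EFin \o g).
    by apply: measurable_funTS; case/integrableP: ig.
  (* The cells [A i] are disjoint subsets of [[0, K]], so their intensities sum to at most M. *)
  rewrite -ge0_integral_bigsetU//; last 4 first.
  - exact: iota_uniq.
  - apply/trivIsetP => i j _ _ ij; apply/seteqP; split => //.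
    move=> x [[_ /= xi] [_ /= xj]].
    move: xi xj; rewrite !in_itv/= => /andP[ix xi] /andP[jx xj].
    have := le_lt_trans ix xj; have := le_lt_trans jx xi.
    rewrite !ltr_pM2r// !ltr_nat !ltnS => ji ij'.
    by move: ij; rewrite eqn_leq ij' ji.
  - exact: mg.
  - by move=> x _; rewrite lee_fin.
  apply: ge0_subset_integral => //.
  - by apply: bigsetU_measurable => i _; exact: mA.
  - exact: mg.
  - by move=> x _; rewrite lee_fin.
  - by rewrite big_mkord -bigcup_mkord; apply: bigcup_sub => i _; exact: AE.
- move=> w [x xw xrw]; have := ppp_support heta xw; have := ppp_support heta xrw.
  move=> /= xrK xK.
  have x0 : 0 <= x / h.
    by move: xK; rewrite in_itv/= => /andP[? _]; rewrite divr_ge0// ltW.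
  (* The cell containing x has index the integer part of x / h, and x + r then lies in [B i]. *)
  have := truncn_itv x0; set i := Num.truncn _ => /andP[ix xi].
  have iN : (i < N)%N.
    rewrite -(ltr_nat R) (le_lt_trans ix)//; apply: le_lt_trans (archi_boundP _).
      by move: xK; rewrite in_itv/= => /andP[_ ?]; rewrite ler_pM2r// invr_gt0.
    by rewrite divr_ge0// ltW.
  rewrite ler_pdivlMr// in ix; rewrite ltr_pdivrMr// in xi.
  rewrite -(bigcup_mkord N (fun i => hit eta (A i) `&` hit eta (B i))).
  exists i => //; split.
    by apply: count_in_gt0 xw _; split => //=; rewrite in_itv/= ix.
  by apply: count_in_gt0 xrw _; split => //=; rewrite in_itv/= lerD2r ix ltrD2r.
Qed.

End diffuse_poisson_process.

(** * Measurability of f_k and the conclusion *)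

Lemma measurable_f_hop (R : realType) (k : nat) (r t : R) :
  measurable_fun setT
    (fun s : k.-1.-tuple (measurableTypeR R) => (f_hop r t s)%:E).
Proof.
have mX l : measurable_fun setT
    (fun s : k.-1.-tuple (measurableTypeR R) => nth 0 (0 :: rcons s t) l : R).
  case: l => [|l] /=; first exact: measurable_cst.
  (* An entry of [rcons s t] is a coordinate of s below index k - 1 and a constant from there on: t
     at k - 1, the default 0 beyond. *)
  rewrite (_ : (fun _ => _) = fun s : k.-1.-tuple (measurableTypeR R) =>
    if insub l is Some i then tnth s i else nth 0 [:: t] (l - k.-1)).
    by case: insubP => [i _ _|_]; [exact: measurable_tnth|exact: measurable_cst].
  apply/funext => s; rewrite nth_rcons size_tuple.
  case: insubP => [i li il|]; first by rewrite li (tnth_nth 0) -il.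
  rewrite -leqNgt; case: ltngtP => // [kl|->] _; rewrite ?subnn//.
  by rewrite -(subnSK kl) nth_default.
apply/measurable_EFinP; rewrite /f_hop /=.
apply: measurable_prod => l _.
have mb : measurable_fun setT (fun s : k.-1.-tuple (measurableTypeR R) =>
    nth 0 (0 :: rcons s t) l.+1 < nth 0 (0 :: rcons s t) l + r :> R).
  by apply: measurable_fun_ltr => //; exact: measurable_funD.
rewrite (_ : (fun _ => _) = fun s : k.-1.-tuple (measurableTypeR R) =>
  if nth 0 (0 :: rcons s t) l.+1 < nth 0 (0 :: rcons s t) l + r
  then 1 else 0 : R).
  exact: measurable_fun_ifT.
by apply/funext => s; case: ifP.
Qed.

Theorem proposition2p1 (R : realType) (d : measure_display)
    (T : measurableType d) (P : probability T R) (k : nat) (hk : (2 <= k)%N)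
    (r : R) (hr : 0 < r) (lam : 'I_k -> R -> R)
    (lam_ge0 : forall l s, 0 <= s <= r -> 0 <= lam l s)
    (lam_int : forall l,
       lebesgue_measure.-integrable `[0, r] (EFin \o lam l))
    (eta : T -> {fset R})
    (heta : poisson_point_process P `[0, k%:R * r] (intensity r lam) eta)
    (t : R) (ht : 0 <= t <= k%:R * r)
    (* k is the least possible number of hops from 0 to t, up to the boundary
       case t = (k - 1) r; the identity fails for smaller t *)
    (ht_min : (k.-1)%:R * r <= t) :
  {ae P, forall w, ((hop_count k r t (eta w))%:R : R)%:E =
    multiple_integral (dN (eta w)) `[0, t]
      (fun s : (k.-1).-tuple R => (f_hop r t s)%:E)}.
Proof.
have g0 := cell_density_ge0 lam_ge0.
have ig := integrable_cell_density lam_int.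
have nodeN := ppp_node_negligible g0 ig heta.
have pairN := ppp_pair_negligible g0 ig heta hr.
(* Off these three null events the identity holds for every w. *)
apply: negligibleS (negligibleU (negligibleU (nodeN r) (nodeN (t - r))) pairN).
move=> w; apply: contra_notP => /not_orP[/not_orP[/= rS tS] pS].
have S0 x : x \in eta w -> 0 <= x.
  by move=> /(ppp_support heta)/=; rewrite in_itv/= => /andP[].
have mI : measurable (`[0, t]%classic : set (measurableTypeR R)).
  exact: measurable_itv.
have f0 (s : k.-1.-tuple (measurableTypeR R)) : (0 <= (f_hop r t s)%:E)%E.
  by rewrite lee_fin; apply: prodr_ge0 => l _.
rewrite [RHS](multiple_integral_dN S0 mI f0 (@measurable_f_hop R k r t)).
rewrite /hop_count -sum1_card natr_sum -sumEFin.
(* Both sides are now sums over the same tuples of nodes and are compared term by term. *)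
rewrite big_mkcond [RHS]big_mkcond; apply: eq_bigr => s _ /=.
rewrite unfold_in /= /f_hop prodr_bool.
have sS x : x \in map val s -> x \in eta w by case/mapP => y _ ->; exact: valP.
rewrite (path_hopE hk hr ht_min); last 5 first.
- by rewrite size_map size_tuple.
- by move=> x /sS /S0.
- by apply: contra_notN rS => /sS.
- by move=> x /sS xS; apply: contra_notN tS => /eqP <-; rewrite addrK.
- move=> x y /sS xS /sS yS; apply: contra_notN pS => /eqP yx.
  by exists x; rewrite -?yx.
(* The range condition in [path_hopE] is the integration domain [[0, t]]. *)
rewrite /= all_map (eq_all (a2 := fun x => val x \in `[0, t]%classic)); last first.
  by move=> x; rewrite /= mem_setE in_itv.
by case: (uniq s) (all _ _) [forall l, _] => [] [] [].
Qed.
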